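(* Let $G$ be a countably infinite amenable group. Then the following are equivalent: (1) $G$ is locally finite; (2) $\Xi_{\mathrm{min}}(G)$ is comeager in $\Xi(G)$.
   Context: $\Omega$ denotes the Cantor space; $\mathrm{Homeo}(\Omega)$ carries the uniform convergence topology. $\Xi(G)=\mathrm{Hom}(G,\mathrm{Homeo}(\Omega))$ is the Polish space of actions of the countable group $G$ on $\Omega$ by homeomorphisms, a closed subspace of $\mathrm{Homeo}(\Omega)^G$. $\Xi_{\mathrm{min}}(G)$ is the set of $\xi\in\Xi(G)$ which are minimal, i.e., such that $\Omega$ has no proper non-empty closed $\xi$-invariant subset. A group is locally finite if all of its finitely generated subgroups are finite. *)

(* Defs.v *)
From HB Require Import structures.
From mathcomp Require Import all_boot all_order all_algebra.
From mathcomp Require Import all_classical all_reals.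
From mathcomp Require Import topology cantor.

Set Implicit Arguments.
Unset Strict Implicit.
Unset Printing Implicit Defensive.

Local Open Scope classical_set_scope.

Definition is_subgroup (G : groupType) (H : set G) : Prop :=
  [/\ H 1%g,
      forall g h, H g -> H h -> H (g * h)%g &
      forall g, H g -> H (g^-1)%g].

Definition generated_subgroup (G : groupType) (S : set G) : set G :=
  smallest (@is_subgroup G) S.

Definition locally_finite (G : groupType) : Prop :=
  forall S : set G, finite_set S -> finite_set (generated_subgroup S).

(* Existence of a left-invariant finitely additive probability measure defined
   on all subsets of the discrete group G. *)
Definition amenable (R : realType) (G : groupType) : Prop :=
  exists m : set G -> R,
    [/\ forall A, (0 <= m A)%R,
        m setT = 1%R,
        forall A B, A `&` B = set0 -> m (A `|` B) = (m A + m B)%R &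
        forall g A, m [set (g * a)%g | a in A] = m A].

Definition nowhere_dense (T : topologicalType) (A : set T) : Prop :=
  (closure A)° = set0.

Definition meager (T : topologicalType) (A : set T) : Prop :=
  exists2 F : nat -> set T,
    forall n, nowhere_dense (F n) & A `<=` \bigcup_n F n.

Definition comeager (T : topologicalType) (A : set T) : Prop := meager (~` A).

Definition is_homeo (T : topologicalType) (f : T -> T) : Prop :=
  continuous f /\
  exists g : T -> T, [/\ continuous g, cancel f g & cancel g f].

(* The group law is composition; the topology is inherited by
   the subtype from the topology of uniform convergence. *)
Definition Homeo_cantor : topologicalType :=
  set_type [set f : {uniform cantor_space -> cantor_space} |
             is_homeo (f : cantor_space -> cantor_space)].

Definition homeo_fun (f : Homeo_cantor) : cantor_space -> cantor_space :=
  set_val f.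

(* Hom(G, Homeo) as a topological subspace of Homeo^G. *)
Definition actions (G : groupType) : topologicalType :=
  set_type [set xi : prod_topology (fun _ : G => Homeo_cantor) |
             forall g h : G,
               homeo_fun (xi (g * h)%g) = homeo_fun (xi g) \o homeo_fun (xi h)].

Definition act (G : groupType) (xi : actions G) (g : G) :
  cantor_space -> cantor_space := homeo_fun (set_val xi g).

Definition minimal_actions (G : groupType) : set (actions G) :=
  [set xi | forall C : set cantor_space, closed C ->
     (forall g : G, act xi g @` C `<=` C) -> C = set0 \/ C = setT].

(* Main.v *)
Require Import Defs.
From HB Require Import structures.
From mathcomp Require Import all_boot all_order all_algebra.
From mathcomp Require Import all_classical all_reals.
From mathcomp Require Import topology cantor.

(** Both directions rest on one way of producing actions, [subsystem_action].
   The group G acts on Omega^G by right translation of the argument, and every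
   non-empty closed invariant subset A of Omega^G becomes, after multiplication
   by a Cantor space carrying the trivial action, a Cantor space with a
   G-action.  So an action of G on Omega can be prescribed by writing down
   closed translation-invariant conditions on functions z : G -> Omega; and if
   the values z 1 of the points of A reach all the cylinders of length n, the
   homeomorphism with Omega can be chosen so that evaluation at 1 is the
   identity up to the first n coordinates.

   Locally finite implies generically minimal.  Minimality is the conjunction
   over k of the open conditions [equidense]: finitely many elements of G carry
   every point into every cylinder of length k.  To approximate an action xi by
   an equidense one on a finite set of group elements, let F be the finite
   subgroup which that set generates, and let F' be a finite subgroup containing
   F and many cosets of F.  Since F-orbits are free in F', there is an
   F-equivariant map y : F' -> Omega whose values meet all cylinders.  The
   functions z : G -> Omega which look like a translate of y on every coset of
   F' form a closed invariant set.  In the action that it defines, F moves the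
   value at 1 by xi, and the orbit of every point under F' meets every cylinder of
   the length considered.

   Generically minimal implies locally finite.  Suppose that a finite set
   generates an infinite subgroup.  Its Cayley graph contains a geodesic ray
   from 1; moving the ray one step along itself and fixing the rest of G is an
   injection g |-> s(g) g of G into itself which misses 1 and uses finitely many
   multipliers s(g).  The functions z : G -> Omega which code such injections
   form a closed invariant set, and this yields an action with a map
   x |-> lambda(x) x which is injective, takes finitely many multipliers
   lambda(x), and misses a cylinder.  These properties survive small
   perturbations of the action, so they hold on a non-empty open set.  None of
   the actions there is minimal: an invariant mean on G, transported along an
   orbit, gives the missed cylinder measure zero, whereas minimality makes
   finitely many translates of that cylinder cover Omega.  As the space of
   actions satisfies the Baire property ([actions_baire]), the minimal actions
   cannot be comeager. *)

Set Implicit Arguments.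
Unset Strict Implicit.
Unset Printing Implicit Defensive.

Import Order.TTheory GRing.Theory Num.Theory.

Local Open Scope classical_set_scope.

(** * The topology of the Cantor space in terms of finite prefixes *)

Local Notation Omega := cantor_space.

Definition agree (n : nat) (x y : Omega) := forall i, (i < n)%N -> x i = y i.

Lemma agree_sym n x y : agree n x y -> agree n y x.
Proof. by move=> xy i /xy. Qed.
Lemma agree_trans n y x z : agree n x y -> agree n y z -> agree n x z.
Proof. by move=> xy yz i iltn; rewrite xy ?yz. Qed.
Lemma agree_le m n x y : (m <= n)%N -> agree n x y -> agree m x y.
Proof. by move=> mn xy i im; apply: xy; exact: leq_trans mn. Qed.
Lemma agree_eq x y : (forall n, agree n x y) -> x = y.
Proof. by move=> xy; apply/funext => i; apply: (xy i.+1). Qed.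

Lemma nbhs_agree n (x : Omega) : nbhs x [set y | agree n x y].
Proof.
elim: n => [|n IH].
  have -> : [set y | agree 0 x y] = setT by apply/seteqP; split=> // y _ i.
  exact: filterT.
have xn : nbhs (x : Omega) [set y : Omega | x n = y n].
  have := @proj_continuous _ (fun _ : nat => bool) n x.
  move=> /(_ [set b | x n = b]); apply.
  by rewrite nbhs_principalE; exact/principal_filterP.
apply: filterS (filterI IH xn).
move=> y [yx yn] i.
by rewrite ltnS leq_eqVlt => /predU1P[->//|]; exact: yx.
Qed.

Lemma nbhs_cantorP (x : Omega) (U : set Omega) :
  nbhs x U <-> exists n, forall y, agree n x y -> U y.
Proof.
split=> [|[n nU]]; last by apply: filterS (nbhs_agree n x); exact: nU.
pose F := filter_from [set: nat] (fun n => [set y | agree n x y]).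
have FF : Filter F.
  apply: filter_from_filter; first by exists 0%N.
  move=> i j _ _; exists (maxn i j) => // y xy; split; apply: agree_le xy.
  - exact: leq_maxl.
  - exact: leq_maxr.
suff : F --> x by move=> /[apply]-[n _ nU]; exists n.
apply/cvg_sup => i V [B [[C oC <-] Cx BV]].
by exists i.+1 => // y xy; apply: BV; rewrite /= -(xy i).
Qed.

Lemma continuous_cantorP (f : Omega -> Omega) :
  continuous f <->
  forall x n, exists m, forall y, agree m x y -> agree n (f x) (f y).
Proof.
split=> [cf x n|cf x U /nbhs_cantorP[n nU]].
  have /nbhs_cantorP[m mU] := cf x _ (nbhs_agree n (f x)).
  by exists m => y /mU.
by have [m mn] := cf x n; apply/nbhs_cantorP; exists m => y /mn /nU.
Qed.

Lemma closed_cantorP (A : set Omega) :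
  closed A <-> forall x, (forall n, exists2 a, A a & agree n x a) -> A x.
Proof.
split=> [clA x xA|clA x xA].
  apply: clA => U /nbhs_cantorP[n nU]; have [a Aa xa] := xA n.
  by exists a; split=> //; exact: nU.
apply: clA => n; have [a [Aa xa]] := xA _ (nbhs_agree n x); by exists a.
Qed.

Lemma open_cylinder n (x : Omega) : open [set y | agree n x y].
Proof.
rewrite openE => y xy; apply/nbhs_cantorP; exists n => z yz.
exact: agree_trans yz.
Qed.

(** Compactness of the Cantor space, for a cover by one cylinder around each point. *)
Lemma cantor_finite_subcover (V : Omega -> nat) :
  exists s : seq Omega, forall y, exists2 x, x \in s & agree (V x) x y.
Proof.
have := cantor_space_compact; rewrite compact_cover.
move=> /(_ _ [set: Omega] (fun x => [set y | agree (V x) x y])).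
case=> [x _||D _ cD]; first exact: open_cylinder.
  by move=> x _; exists x.
exists (finmap.enum_fset D) => y; have [x xD xy] := cD y I; by exists x.
Qed.

Lemma unif_continuous_cantor (f : Omega -> Omega) n : continuous f ->
  exists m, forall x y, agree m x y -> agree n (f x) (f y).
Proof.
move=> /continuous_cantorP cf.
have /choice[V Vf] := fun x => cf x n.
have [s sV] := cantor_finite_subcover V.
exists (\max_(x <- s) V x)%N => x y xy.
have [z zs zx] := sV x.
have zy : agree (V z) z y.
  by apply: agree_trans zx _; apply: agree_le xy; exact: leq_bigmax_seq.
by apply: agree_trans (agree_sym (Vf _ _ zx)) (Vf _ _ zy).
Qed.

(** The Cantor space is compact, so its uniformity is determined by its topology:
   both implications are Lebesgue-number arguments over a finite cover by
   cylinders. *)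
Lemma entourage_cantorP (E : set (Omega * Omega)) :
  entourage E <-> exists n, forall x y, agree n x y -> E (x, y).
Proof.
have section_cantor (F : Omega -> set (Omega * Omega)) :
    (forall z, entourage (F z)) -> exists V : Omega -> nat,
    forall z y, agree (V z) z y -> F z (z, y).
  move=> entF; suff /choice[V VF] : forall z, exists m : nat,
      forall y, agree m z y -> F z (z, y) by exists V.
  move=> z; have /nbhs_cantorP[m mE] := nbhs_entourage z (entF z).
  by exists m => y /mE/xsectionP.
split=> [entE|[n nE]].
  have [V VE] := section_cantor (fun=> split_ent E `&` (split_ent E)^-1%relation)
    (fun=> entourage_invI (entourage_split_ent entE)).
  have [s sV] := cantor_finite_subcover V.
  exists (\max_(x <- s) V x)%N => x y xy.
  have [z zs zx] := sV x.
  have zy : agree (V z) z y.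
    by apply: agree_trans zx _; apply: agree_le xy; exact: leq_bigmax_seq.
  have [_ Exz] := VE _ _ zx; have [Ezy _] := VE _ _ zy.
  exact: (entourage_split z).
have /choice[F FP] : forall z : Omega, exists F : set (Omega * Omega),
    entourage F /\ forall y, F (z, y) -> agree n z y.
  move=> z; have := nbhs_agree n z.
  rewrite -nbhs_entourageE => -[F entF Fz]; exists F; split=> // y Fzy.
  by apply: Fz; exact/xsectionP.
have [V VF] := section_cantor (fun z => split_ent (F z))
  (fun z => entourage_split_ent (proj1 (FP z))).
have [s sV] := cantor_finite_subcover V.
have [D entD DF] : exists2 D : set (Omega * Omega), entourage D &
    forall z, z \in s -> D `<=` split_ent (F z).
  elim: s {sV} => [|z s [D entD DF]]; first by exists setT => //; exact: entourageT.
  exists (split_ent (F z) `&` D).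
    by apply: filterI => //; apply/entourage_split_ent; exact: (proj1 (FP z)).
  by move=> w; rewrite inE => /predU1P[-> p []//|/DF Dw p [_ /Dw]].
apply: filterS entD => -[x y] Dxy; apply: nE.
have [z zs zx] := sV x.
have [entF Fz] := FP z.
have Fzx : split_ent (F z) (z, x) by exact: VF.
apply: (agree_trans (agree_sym (Fz _ _)) (Fz _ _)).
  exact: split_ent_subset Fzx.
by apply: (entourage_split x) => //; exact: DF Dxy.
Qed.

(** * The space of actions *)

Lemma nbhs_set_typeP (T : topologicalType) (A : set T) (x : A) (U : set A) :
  nbhs x U <-> exists2 V, nbhs (set_val x) V & forall y : A, V (set_val y) -> U y.
Proof.
split=> [[_ [[B oB <-] Bx BU]]|[V]].
  by exists B; [exact: open_nbhs_nbhs | exact: BU].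
rewrite nbhsE => -[B [oB Bx] BV VU]; exists (set_val @^-1` B).
by split=> // [|y /BV/VU//]; exists B.
Qed.

Lemma nbhs_homeoP (f : Homeo_cantor) (U : set Homeo_cantor) :
  nbhs f U <-> exists n, forall h : Homeo_cantor,
    (forall x, agree n (homeo_fun f x) (homeo_fun h x)) -> U h.
Proof.
rewrite nbhs_set_typeP; split=> [[V]|[n nU]].
  move=> /uniform_nbhs[E [/entourage_cantorP[n nE] EV] VU].
  by exists n => h fh; apply/VU/EV => x _; exact/nE/fh.
exists [set h | forall x, agree n (homeo_fun f x) (h x)] => //.
apply/uniform_nbhs; exists [set p | agree n p.1 p.2]; split.
  by apply/entourage_cantorP; exists n.
by move=> h fh x; exact: fh.
Qed.

Section Actions.
Variables (G : groupType) (e : G -> nat).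
Hypothesis e_inj : injective e.

(** The single parameter n bounds both the group elements that are looked at,
   through the numbering e, and the precision on each of them. *)
Definition close_upto n (xi xi' : actions G) :=
  forall g, (e g < n)%N -> forall x, agree n (act xi g x) (act xi' g x).

Lemma close_upto_le m n xi xi' : (m <= n)%N ->
  close_upto n xi xi' -> close_upto m xi xi'.
Proof.
move=> mn close g gm x; apply: (agree_le mn); apply: close; exact: leq_trans mn.
Qed.

(** This is the only place where the topology of the space of actions is unfolded.
   Since e is injective, only finitely many group elements have a number below
   n, which makes the sets [close_upto n xi] neighbourhoods. *)
Lemma nbhs_actionsP (xi : actions G) (U : set (actions G)) :
  nbhs xi U <-> exists n, forall xi', close_upto n xi xi' -> U xi'.
Proof.
split=> [|[n nU]].
  pose F := filter_from [set: nat] (fun n => [set xi' | close_upto n xi xi']).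
  have FF : Filter F.
    apply: filter_from_filter; first by exists 0%N.
    move=> i j _ _; exists (maxn i j) => // y xy; split; apply: close_upto_le xy.
    - exact: leq_maxl.
    - exact: leq_maxr.
  suff : F --> xi by move=> /[apply]-[n _ nU]; exists n.
  move=> V /nbhs_set_typeP[W nW WV].
  suff : (set_val @ F) --> set_val xi by move=> /(_ W nW); apply: filterS WV.
  apply/cvg_sup => g W' [B [[C oC <-] Cx BW]].
  have nC : nbhs (set_val xi g : Homeo_cantor) C.
    by apply: open_nbhs_nbhs; split; [exact: oC | exact: Cx].
  have /nbhs_homeoP[m mC] := nC.
  (* (e g).+1 so that g itself is among the elements controlled. *)
  exists (maxn (e g).+1 m) => // xi' close; apply: BW; apply: mC => x.
  by apply: agree_le (close _ _ x); [exact: leq_maxr | exact: leq_maxl].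
suff close_nbhs k : nbhs xi [set xi' | forall g, (e g < k)%N ->
    forall x, agree n (act xi g x) (act xi' g x)].
  by apply: filterS (close_nbhs n).
elim: k => [|k IH].
  by apply: filterS filterT.
have [[g eg]|gk] := pselect (exists g, e g = k); last first.
  apply: filterS IH => xi' xi'k g; rewrite ltnS leq_eqVlt => /predU1P[eg|].
    by case: gk; exists g.
  exact: xi'k.
have near_g : nbhs xi [set xi' | forall x, agree n (act xi g x) (act xi' g x)].
  apply/nbhs_set_typeP.
  exists (proj g @^-1` [set h | forall x, agree n (act xi g x) (homeo_fun h x)]) => //.
  apply: (@proj_continuous _ (fun=> Homeo_cantor) g (set_val xi)).
  by apply/nbhs_homeoP; exists n.
apply: filterS (filterI IH near_g) => xi' [xi'k xi'g] h.
rewrite ltnS leq_eqVlt => /predU1P[eh|]; last exact: xi'k.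
by rewrite (e_inj (etrans eh (esym eg))).
Qed.
End Actions.

Section ActionLaws.
Variable (G : groupType).

Lemma act_is_homeo (xi : actions G) g : is_homeo (act xi g).
Proof. exact: set_valP (set_val xi g). Qed.

Lemma act_continuous (xi : actions G) g : continuous (act xi g).
Proof. by case: (act_is_homeo xi g). Qed.

Lemma actM (xi : actions G) g h x : act xi (g * h)%g x = act xi g (act xi h x).
Proof. by have /(congr1 (fun f => f x)) := set_valP xi g h. Qed.

Lemma act1 (xi : actions G) x : act xi 1%g x = x.
Proof.
have [_ [k [_ kK _]]] := act_is_homeo xi 1%g.
by rewrite -[LHS]kK -actM mul1g kK.
Qed.

Lemma actK (xi : actions G) g : cancel (act xi g) (act xi g^-1%g).
Proof. by move=> x; rewrite -actM mulVg act1. Qed.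

(** Invertibility comes for free: the inverse of f g is f g^-1. *)
Lemma mk_action (f : G -> Omega -> Omega) :
  (forall g, continuous (f g)) -> (forall x, f 1%g x = x) ->
  (forall g h x, f (g * h)%g x = f g (f h x)) ->
  exists xi : actions G, forall g x, act xi g x = f g x.
Proof.
move=> fc f1 fM.
have fH g : is_homeo (f g).
  split=> //; exists (f g^-1%g); split=> // x; first by rewrite -fM mulVg f1.
  by rewrite -fM mulgV f1.
pose h g : Homeo_cantor := SigSub (mem_set (fH g)).
have hM : forall g g', homeo_fun (h (g * g')%g) = homeo_fun (h g) \o homeo_fun (h g').
  by move=> g g'; apply/funext => x /=; exact: fM.
by exists (SigSub (mem_set hM)).
Qed.
End ActionLaws.

(** * The Baire property of the space of actions *)

Lemma close_upto_trans (G : groupType) (e : G -> nat) n (xi2 xi1 xi3 : actions G) :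
  close_upto e n xi1 xi2 -> close_upto e n xi2 xi3 -> close_upto e n xi1 xi3.
Proof.
by move=> c12 c23 g gn x; apply: agree_trans (c12 g gn x) (c23 g gn x).
Qed.

Section Baire.
Variables (G : groupType) (e : G -> nat).
Hypothesis e_inj : injective e.
Local Notation close := (close_upto e).

(** Completeness.  The uniform metric on homeomorphisms is not complete in general,
   but here the inverse of the image of g is the image of g^-1, which converges
   too, so the limit is again made of homeomorphisms. *)
Lemma cauchy_actions_limit (s : nat -> actions G) (r : nat -> nat) :
  (forall n, (n <= r n)%N) ->
  (forall n m, (n <= m)%N -> close (r n) (s n) (s m)) ->
  exists xi, forall n, close (r n) (s n) xi.
Proof.
move=> rn sC.
(* From the index bounding both e g and i on, coordinate i is constant. *)
pose lim g x : Omega := fun i => act (s (maxn (e g) i).+1) g x i.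
have limP n g x : (e g < r n)%N -> agree (r n) (act (s n) g x) (lim g x).
  move=> gn i ir; rewrite /lim; set k := (maxn (e g) i).+1.
  have kr : (k <= r k)%N by [].
  rewrite (sC n (maxn n k) (leq_maxl _ _) g gn x i ir).
  rewrite (sC k (maxn n k) (leq_maxr _ _) g _ x i) //; apply: leq_trans kr.
    by rewrite ltnS leq_maxl.
  by rewrite ltnS leq_maxr.
have limN n g x : (e g < n)%N -> agree n (act (s n) g x) (lim g x).
  move=> gn; apply: agree_le (limP n g x _) => //; exact: leq_trans (rn n).
have limC g : continuous (lim g).
  apply/continuous_cantorP => x n; pose k := maxn (e g).+1 n.
  have /continuous_cantorP/(_ x n)[m mP] := @act_continuous _ (s k) g.
  have limk y : agree n (act (s k) g y) (lim g y).
    by apply: agree_le (limN k g y _); [exact: leq_maxr|exact: leq_maxl].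
  exists m => y /mP xy.
  exact: agree_trans (agree_sym (limk x)) (agree_trans xy (limk y)).
have lim1 x : lim 1%g x = x by apply/funext => i; rewrite /lim act1.
have limM g h x : lim (g * h)%g x = lim g (lim h x).
  apply: agree_eq => n.
  have /continuous_cantorP/(_ (lim h x) n)[m mP] := limC g.
  pose k := maxn (maxn n m) (maxn (e (g * h)%g).+1 (maxn (e g).+1 (e h).+1)).
  have kn : (n <= k)%N by rewrite !leq_max leqnn.
  have km : (m <= k)%N by rewrite !leq_max leqnn orbT.
  have kgh : (e (g * h)%g < k)%N by rewrite !leq_max leqnn !orbT.
  have kg : (e g < k)%N by rewrite !leq_max leqnn !orbT.
  have kh : (e h < k)%N by rewrite !leq_max leqnn !orbT.
  apply: agree_trans (agree_le kn (agree_sym (limN k _ x kgh))) _.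
  rewrite actM; apply: agree_trans (agree_le kn (limN k g _ kg)) _.
  apply/agree_sym/mP/agree_sym/(agree_le km); exact: limN.
have [xi xiE] := mk_action limC lim1 limM.
by exists xi => n g gn x; rewrite xiE; exact: limP.
Qed.

(** The usual nested-ball argument: shrink a basic neighbourhood so as to avoid
   one nowhere dense set after the other, and take the limit of the centres. *)
Lemma actions_baire (V : set (actions G)) : open V -> V !=set0 -> ~ meager V.
Proof.
move=> oV [xi0 Vxi0] [F F0 VF].
have /(nbhs_actionsP e_inj)[r0 r0V] : nbhs xi0 V by exact: open_nbhs_nbhs.
have step (p : actions G * nat * nat) : exists q : actions G * nat,
    [/\ (p.1.2 < q.2)%N, close p.1.2 p.1.1 q.1 &
        forall xi, close q.2 q.1 xi -> ~ F p.2 xi].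
  move: p => [[xi r] n] /=.
  have [xi' xixi' Fxi'] : exists2 xi', close r xi xi' & ~ closure (F n) xi'.
    apply: contrapT => noxi; have : (closure (F n))° xi.
      apply/(nbhs_actionsP e_inj); exists r => xi' xixi'.
      by apply: contrapT => nF; apply: noxi; exists xi'.
    by rewrite F0.
  have : nbhs xi' (~` closure (F n)).
    by apply: open_nbhs_nbhs; split=> //; apply/closed_openC/closed_closure.
  move=> /(nbhs_actionsP e_inj)[k kF].
  exists (xi', maxn r.+1 k); split=> //=; first exact: leq_maxl.
  move=> xi'' c Fxi''; apply: (kF xi''); last exact: subset_closure.
  by apply: close_upto_le c; exact: leq_maxr.
have [f fP] := choice step.
pose t := fix t n := if n is m.+1 then f (t m, m) else (xi0, r0).
pose s n := (t n).1; pose r n := (t n).2.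
have rS n : (r n < r n.+1)%N by case: (fP (t n, n)).
have sS n : close (r n) (s n) (s n.+1) by case: (fP (t n, n)).
have sF n xi : close (r n.+1) (s n.+1) xi -> ~ F n xi.
  by case: (fP (t n, n)) => _ _; apply.
have rn n : (n <= r n)%N by elim: n => // n IH; exact: leq_ltn_trans (rS n).
have rle n m : (n <= m)%N -> (r n <= r m)%N.
  by apply: (homo_leq (@leqnn) (@leq_trans)) => k; exact: ltnW.
have sC n m : (n <= m)%N -> close (r n) (s n) (s m).
  elim: m => [|m IH]; first by rewrite leqn0 => /eqP-> g _ x.
  rewrite leq_eqVlt => /predU1P[->|]; first by move=> g _ x.
  rewrite ltnS => nm; apply: close_upto_trans (IH nm) _.
  by apply: close_upto_le (sS m); exact: rle.
have [xi xiP] := cauchy_actions_limit rn sC.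
have [n _ Fxi] := VF _ (r0V _ (xiP 0%N)).
exact: sF (xiP n.+1) Fxi.
Qed.
End Baire.

(** * Closed subsets of the Cantor space without isolated points *)

Lemma clopen_cylinder n (x : Omega) : clopen [set y | agree n x y].
Proof.
split; first exact: open_cylinder.
apply/closed_cantorP => y /(_ n)[z xz yz].
exact: agree_trans xz (agree_sym yz).
Qed.

Lemma closed_perfect_cantor_like (A : set Omega) :
  closed A ->
  (forall x n, A x -> exists y, [/\ A y, agree n x y & x <> y]) ->
  cantor_like (set_type A).
Proof.
move=> clA perfA.
have val_cts : continuous (set_val : A -> Omega).
  exact: (@initial_continuous _ Omega set_val).
split.
- apply/perfectTP_ex => U oU [x Ux].
  have /nbhs_set_typeP[V /nbhs_cantorP[n nV] VU] : nbhs x U by exact: open_nbhs_nbhs.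
  have [y [Ay xy nxy]] := perfA (set_val x) n (set_valP x).
  exists x, (SigSub (mem_set Ay)); split=> //.
    by apply: VU; exact: nV.
  by apply/eqP => xE; apply: nxy; rewrite xE.
- move=> F FF _.
  have [p [_ clp]] := cantor_space_compact (fmap_proper_filter set_val FF) filterT.
  have Ap : A p.
    apply: clA => B nB.
    have GA : (set_val @ F) A.
      by apply: (@filterS _ F _ setT) filterT => z _; exact: (@set_valP _ A z).
    exact: clp GA nB.
  exists (SigSub (mem_set Ap)); split=> // P Q FP /nbhs_set_typeP[V nV VQ].
  have GP : (set_val @ F) (set_val @` P).
    by apply: (@filterS _ F _ P) => // y Py; exists y.
  have [z [[y Py <-] Vz]] := clp _ _ GP nV.
  by exists y; split=> //; exact: VQ.
- move=> x y clxy; apply/val_inj/agree_eq => n.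
  have nbhs_val (z : A) : nbhs z (set_val @^-1` [set w | agree n (set_val z) w]).
    by apply: val_cts; exact: nbhs_agree.
  have [z [xz yz]] := clxy _ _ (nbhs_val x) (nbhs_val y).
  exact: agree_trans xz (agree_sym yz).
- move=> x y xy; have [n nxy] : exists n, ~ agree n (set_val x) (set_val y).
    apply: contrapT => nex; move/eqP: xy; apply; apply/val_inj/agree_eq => n.
    by apply: contrapT => nxy; apply: nex; exists n.
  exists (set_val @^-1` [set w | agree n (set_val x) w]); split=> //.
  by apply: preimage_clopen => //; exact: clopen_cylinder.
Qed.

(** Brouwer's characterization of the Cantor space, for its closed subsets. *)
Lemma closed_perfect_cantor (R : realType) (A : set Omega) :
  closed A -> A !=set0 ->
  (forall x n, A x -> exists y, [/\ A y, agree n x y & x <> y]) ->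
  exists theta : Omega -> Omega,
    [/\ continuous theta, injective theta & range theta = A].
Proof.
move=> clA [a Aa] perfA.
pose X : pseudoMetricType R := set_type (A : set (prod_topology (fun _ : nat => bool))).
pose Y : pseudoPMetricType R := HB.pack X (isPointed.Build X (SigSub (mem_set Aa))).
have canY : cantor_like Y := closed_perfect_cantor_like clA perfA.
have val_cts : continuous (set_val : Y -> Omega).
  exact: (@initial_continuous _ Omega (set_val : A -> _)).
have [f [fc _]] := homeomorphism_cantor_like canY.
exists (set_val \o f); split.
- move=> x; apply: continuous_comp; [exact: fc|exact: val_cts].
- move=> x y /= /val_inj fxy; have : set_inj [set: Omega] f by exact: inj.
  by apply=> //; rewrite inE.
- apply/seteqP; split=> [_ [x _ <-]|x Ax]; first exact: (@set_valP _ A (f x)).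
  have : set_surj [set: Omega] [set: Y] f by exact: surj.
  by move=> /(_ (SigSub (mem_set Ax)) I)[y _ fy]; exists y => //=; rewrite fy.
Qed.

(** A version of [closed_perfect_cantor] in which the homeomorphism respects a map p
   up to n coordinates.  It is glued from homeomorphisms onto the pieces of A on
   which the first n coordinates of p are constant; the induction on n splits
   off one coordinate at a time. *)
Lemma cantor_parametrization (R : realType) n (A : set Omega) (p : Omega -> Omega) :
  closed A ->
  (forall x n, A x -> exists y, [/\ A y, agree n x y & x <> y]) ->
  continuous p ->
  (forall x, exists2 a, A a & agree n x (p a)) ->
  exists theta : Omega -> Omega,
    [/\ continuous theta, injective theta, range theta = A &
        forall x, agree n x (p (theta x))].
Proof.
elim: n A p => [|n IH] A p clA perfA cp pA.
  have A0 : A !=set0 by have [a Aa _] := pA (fun=> true); exists a.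
  by have [theta [tc ti tA]] := closed_perfect_cantor R clA A0 perfA; exists theta.
have /continuous_cantorP cp' := cp.
have /choice[theta thetaP] : forall b : bool, exists theta : Omega -> Omega,
    [/\ continuous theta, injective theta, range theta = A `&` [set a | p a 0%N = b] &
        forall x, agree n x (fun i => p (theta x) i.+1)].
  move=> b.
  have p0 x : exists m, forall y, agree m x y -> p x 0%N = p y 0%N.
    by have [m mP] := cp' x 1%N; exists m => y /mP; apply.
  apply: (IH _ (fun a i => p a i.+1)).
  - move/closed_cantorP : clA => clA; apply/closed_cantorP => x xA; split.
      by apply: clA => k; have [a [Aa _] xa] := xA k; exists a.
    by have [m mP] := p0 x; have [a [_ <-] /mP] := xA m.
  - move=> x k [Ax px]; have [m mP] := p0 x.
    have [y [Ay xy nxy]] := perfA x (maxn m k) Ax.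
    exists y; split=> //; last by apply: agree_le xy; exact: leq_maxr.
    by split=> //; rewrite /= -(mP y) //; apply: agree_le xy; exact: leq_maxl.
  - apply/continuous_cantorP => x k; have [m mP] := cp' x k.+1.
    by exists m => y /mP xy i ik; exact: xy.
  - move=> x; have [a Aa xa] := pA (fun i => if i is j.+1 then x j else b).
    exists a; first by split=> //; rewrite /= -(xa 0%N).
    by move=> i ilt; rewrite -(xa i.+1).
have thA b x : A (theta b x) /\ p (theta b x) 0%N = b.
  by have [_ _ tA _] := thetaP b; have : range (theta b) (theta b x) by []; rewrite tA.
exists (fun x => theta (x 0%N) (fun i => x i.+1)); split.
- apply/continuous_cantorP => x k.
  have [/continuous_cantorP/(_ (fun i => x i.+1) k)[m mP] _ _ _] := thetaP (x 0%N).
  by exists m.+1 => y xy; rewrite -(xy 0%N)//; apply: mP => i im; exact: xy.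
- move=> x y txy; have xy0 : x 0%N = y 0%N.
    by rewrite -(proj2 (thA (x 0%N) (fun i => x i.+1))) txy (proj2 (thA _ _)).
  apply/funext => -[//|i]; have [_ ti _ _] := thetaP (x 0%N).
  by move: txy; rewrite -xy0 => /ti/(congr1 (fun f => f i)).
- apply/seteqP; split=> [_ [x _ <-]|a Aa]; first by case: (thA (x 0%N) (fun i => x i.+1)).
  have [_ _ tA _] := thetaP (p a 0%N).
  have : range (theta (p a 0%N)) a by rewrite tA.
  by case=> x _ <-; exists (fun i => if i is j.+1 then x j else p a 0%N).
- move=> x [_|i ilt]; first by rewrite (proj2 (thA _ _)).
  by have [_ _ _ tx] := thetaP (x 0%N); exact: (tx _ i).
Qed.

(** * Actions from closed translation-invariant sets of functions on the group *)

(** A continuous injection of a compact space is an embedding, so a map f that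
   theta intertwines with a continuous map is continuous. *)
Lemma continuous_conjugate (theta f F : Omega -> Omega) :
  continuous theta -> injective theta -> continuous F ->
  (forall x, theta (f x) = F (theta x)) -> continuous f.
Proof.
move=> tc ti Fc tf; apply/continuous_closedP => C clC.
have -> : f @^-1` C = (F \o theta) @^-1` (theta @` C).
  apply/seteqP; split=> x /=; rewrite -tf; first by exists (f x).
  by case=> y Cy /ti <-.
have FtC : continuous (F \o theta).
  by move=> x; apply: continuous_comp; [exact: tc | exact: Fc].
move/continuous_closedP : FtC; apply.
apply: (compact_closed cantor_space_hausdorff).
apply: continuous_compact; first exact: continuous_subspaceT.
by apply: (subclosed_compact clC cantor_space_compact).
Qed.

Section Subsystem.
Variables (R : realType) (G : groupType) (e : G -> nat).
Hypothesis e_inj : injective e.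

(** Closedness in the product topology of Omega^G. *)
Definition finitely_closed (A : set (G -> Omega)) :=
  forall z, (forall n, exists2 a, A a &
    forall g, (e g < n)%N -> agree n (z g) (a g)) -> A z.

(** The point theta x of A is the itinerary of x.  The set A may well have isolated
   points.  Functions z : G -> Omega are therefore coded by points of Omega which
   have infinitely many coordinates to spare; on these the group acts trivially,
   and they make the set of codes perfect, hence a Cantor space. *)
Lemma subsystem_action n (A : set (G -> Omega)) :
  finitely_closed A ->
  (forall z g, A z -> A (fun h => z (h * g)%g)) ->
  (forall x, exists2 z, A z & agree n x (z 1%g)) ->
  exists (xi : actions G) (theta : Omega -> G -> Omega),
    [/\ range theta = A, continuous (theta^~ 1%g),
        forall g x h, theta (act xi g x) h = theta x (h * g)%g &
        forall x, agree n x (theta x 1%g)].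
Proof.
move=> clA invA A1.
(* Values of z are stored at even places only, so that the odd ones are to spare. *)
pose code (p : G * nat) := (pickle (e p.1, p.2)).*2.
have code_inj : injective code.
  by move=> [g i] [h j] /double_inj/(pcan_inj pickleK)[/e_inj -> ->].
have [decode decodeP] : exists decode : nat -> option (G * nat),
    forall k p, decode k = Some p <-> code p = k.
  have /choice[d dP] : forall k, exists q : option (G * nat),
      forall p, q = Some p <-> code p = k.
    move=> k; have [[p pk]|npk] := pselect (exists p, code p = k).
      exists (Some p) => q; split=> [[<-]//|qk].
      by congr Some; apply: code_inj; rewrite pk qk.
    by exists None => p; split=> // pk; case: npk; exists p.
  by exists d.
have codeK p : decode (code p) = Some p by apply/decodeP.
pose dec (x : Omega) (h : G) : Omega := fun i => x (code (h, i)).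
pose tr g (x : Omega) : Omega := fun k =>
  if decode k is Some (h, i) then x (code (h * g, i)%g) else x k.
have dec_tr g x h : dec (tr g x) h = dec x (h * g)%g.
  by apply/funext => i; rewrite /dec /tr codeK.
have decA x g : A (dec x) -> A (dec (tr g x)).
  by move=> /(invA _ g); congr A; apply/funext => h; rewrite dec_tr.
have dec_surj z : exists x, dec x = z.
  exists (fun k => if decode k is Some (h, i) then z h i else true).
  by apply/funext => h; apply/funext => i; rewrite /dec codeK.
have dec_cts h : continuous (dec^~ h).
  apply/continuous_cantorP => x k.
  exists (\max_(i < k) (code (h, i : nat)).+1)%N => y xy i ik; apply: xy.
  exact: (leq_bigmax (Ordinal ik)).
have tr_cts g : continuous (tr g).
  apply/continuous_cantorP => x k.
  pose src j := if decode j is Some (h, i) then code (h * g, i)%g else j.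
  exists (\max_(j < k) (src j).+1)%N => y xy j jk.
  have : x (src j) = y (src j) by apply: xy; exact: (leq_bigmax (Ordinal jk)).
  by rewrite /tr /src; case: (decode j) => [[h i]|].
have trM g h x : tr (g * h)%g x = tr g (tr h x).
  apply/funext => k; rewrite /tr; case: (decode k) => [[l i]|//].
  by rewrite codeK mulgA.
have tr1 x : tr 1%g x = x.
  apply/funext => k; rewrite /tr.
  by case dk: (decode k) => [[l i]|//]; rewrite mulg1; move/decodeP : dk => ->.
have [theta [tc ti tB tn]] : exists theta : Omega -> Omega,
    [/\ continuous theta, injective theta, range theta = [set x | A (dec x)] &
        forall x, agree n x (dec (theta x) 1%g)].
  apply: (cantor_parametrization R _ _ (dec_cts 1%g)).
  - apply/closed_cantorP => x xA; apply: clA => k.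
    pose N := (\max_(p <- [seq (i, j) | i <- iota 0 k, j <- iota 0 k])
      (pickle p).*2.+1)%N.
    have [a Aa xa] := xA N; exists (dec a) => // g gk i ik.
    apply: xa; apply: (leq_bigmax_seq (F := fun p => (pickle p).*2.+1) (e g, i)) => //.
    by apply/allpairsP; exists (e g, i); rewrite !mem_iota.
  (* Flipping a spare coordinate beyond k does not change the coded function. *)
  - move=> x k Ax; exists (fun j => if j == k.*2.+1 then ~~ x j else x j).
    split.
    + move: Ax; congr A; apply/funext => h; apply/funext => i; rewrite /dec.
      by case: eqP => // /(congr1 odd); rewrite /= !odd_double.
    + move=> i ik; case: eqP => // ie; move: ik; rewrite ie ltnNge.
      by rewrite -addnn -addnS leq_addr.
    + move=> /(congr1 (fun x => x k.*2.+1)); rewrite eqxx.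
      by case: (x _).
  - move=> x; have [z Az xz] := A1 x; have [y yz] := dec_surj z.
    by exists y; rewrite /= yz.
have tA x : A (dec (theta x)).
  by have : range theta (theta x) by []; rewrite tB.
have /choice[act0 act0P] : forall p : G * Omega, exists y,
    theta y = tr p.1 (theta p.2).
  move=> p; have : range theta (tr p.1 (theta p.2)) by rewrite tB; exact: decA.
  by case=> y _ <-; exists y.
have [xi xiE] : exists xi : actions G, forall g x, act xi g x = act0 (g, x).
  apply: (mk_action (f := fun g x => act0 (g, x))) => [g|x|g h x] /=.
  - by apply: (continuous_conjugate tc ti (tr_cts g)) => x; rewrite act0P.
  - by apply: ti; rewrite act0P tr1.
  - by apply: ti; rewrite !act0P trM.
exists xi, (fun x => dec (theta x)); split=> //.
- apply/seteqP; split=> [_ [x _ <-]//|z Az].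
  have [y yz] := dec_surj z.
  have : range theta y by rewrite tB /= yz.
  by case=> x _ xy; exists x => //; rewrite xy.
- have dtc : continuous ((dec^~ 1%g) \o theta).
    by move=> x; apply: continuous_comp; [exact: tc | exact: dec_cts].
  exact: dtc.
- by move=> g x h; rewrite xiE act0P dec_tr.
Qed.
End Subsystem.

(** * Generic minimality for locally finite groups *)

Lemma finite_set_bound (T : eqType) (A : set T) (M : T -> nat) :
  finite_set A -> exists m, forall x, A x -> (M x <= m)%N.
Proof.
move=> /finite_seqP[s ->]; exists (\max_(x <- s) M x)%N => x xs.
exact: leq_bigmax_seq.
Qed.

Section Groups.
Variable G : groupType.

Lemma generated_is_subgroup (S : set G) : is_subgroup (generated_subgroup S).
Proof.
split=> [H [[]]//|g h gS hS H HS|g gS H HS].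
  by have [[_ HM _] _] := HS; apply: HM; [exact: gS | exact: hS].
by have [[_ _ HV] _] := HS; apply: HV; exact: gS.
Qed.

Lemma sub_generated (S : set G) : S `<=` generated_subgroup S.
Proof. by move=> g Sg H [_]; exact. Qed.

(** Right cosets F g are determined by g as sets, so a choice of a point in each of
   them is a function on G that is constant on cosets. *)
Lemma coset_representatives (F : set G) : is_subgroup F ->
  exists r : G -> G, (forall f g, F f -> r (f * g)%g = r g) /\
                     (forall g, F (g * (r g)^-1)%g).
Proof.
move=> [F1 FM FV].
exists (fun g => xget 1%g [set h | F (g * h^-1)%g]); split=> [f g Ff|g].
  congr (xget _ _); apply/seteqP; split=> h /=; rewrite -mulgA => Fh; last exact: FM.
  by rewrite -(mulKg f (g * _)%g); apply: FM => //; exact: FV.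
by apply: (@xgetPex _ 1%g [set h | F (g * h^-1)%g]); exists g; rewrite /= mulgV.
Qed.

End Groups.

Section LocallyFinite.
Variables (R : realType) (G : groupType) (e : G -> nat).
Hypothesis e_inj : injective e.
Hypothesis G_infinite : infinite_set [set: G].
Hypothesis G_lf : locally_finite G.

(** Density of all orbits at scale k.  Demanding one finite set s for all points
   is what makes the condition open. *)
Definition equidense k : set (actions G) :=
  [set xi | exists s : seq G,
     forall x u, exists2 h, h \in s & agree k u (act xi h x)].

Lemma finite_below n : finite_set [set g | (e g < n)%N].
Proof.
apply: (@finite_preimage _ _ `I_n e); last exact: finite_II.
by move=> x y _ _; exact: e_inj.
Qed.

(** The map y of the proof is equivariant under the finite group F on which xi has
   to be approximated, and near every point of Omega it takes some value on the
   larger finite group F'.  An element of A is a function on G that coincides with a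
   right translate of y on each coset F' g: equivariance makes F act on the value
   at 1 as it does in xi, and the F'-orbit of any point runs, up to m
   coordinates, through all the values of y. *)
Lemma equidense_dense xi n k : exists2 xi', close_upto e n xi xi' & equidense k xi'.
Proof.
wlog kn : n / (k <= n)%N => [H|].
  have [xi' c d] := H (maxn n k) (leq_maxr _ _); exists xi' => //.
  by apply: close_upto_le c; exact: leq_maxl.
pose F := generated_subgroup [set g | (e g < n)%N].
have Fsub : is_subgroup F := generated_is_subgroup _.
have [F1 FM FV] := Fsub.
have Ffin : finite_set F by apply: G_lf; exact: finite_below.
have [m nm mP] : exists2 m, (n <= m)%N & forall g, F g ->
    forall x y, agree m x y -> agree n (act xi g x) (act xi g y).
  have /choice[M MP] : forall g, exists m, forall x y,
      agree m x y -> agree n (act xi g x) (act xi g y).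
    by move=> g; apply: unif_continuous_cantor; exact: act_continuous.
  have [m mM] := finite_set_bound M Ffin.
  exists (maxn n m) => [|g Fg x y xy]; first exact: leq_maxl.
  by apply: MP; apply: agree_le xy; apply: leq_trans (mM g Fg) _; exact: leq_maxr.
(* The representatives are infinite in number because G is infinite and F finite;
   on them y may be chosen freely. *)
have [r [rF Fr]] := coset_representatives Fsub.
have rr g : r (r g) = r g.
  by rewrite -[in LHS](mulKg (g * (r g)^-1)%g (r g)) mulgVK; apply: rF; exact: FV.
have r_infinite : infinite_set (range r).
  move=> r_fin; apply: G_infinite.
  apply: (@sub_finite_set _ _ ((fun p : G * G => (p.1 * p.2)%g) @` (F `*` range r))).
    move=> g _; exists (g * (r g)^-1, r g)%g => /=; last by rewrite mulgVK.
    by split; [exact: Fr | exists g].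
  by apply: finite_image; exact: finite_setX.
have [t t_inj rt] : exists2 t : nat -> G, injective t & forall i, r (t i) = t i.
  pose pG : pointedType := HB.pack G (isPointed.Build G 1%g).
  have /infiniteP/(@pcard_leP _ pG)[t] := r_infinite.
  exists t => [i j tij|i]; first by apply: (@inj _ _ _ t) => //; rewrite inE.
  by have [h _ <-] : range r (t i) by exact: (@funS _ _ _ _ t).
have [s sP] := cantor_finite_subcover (fun=> m).
have /choice[v vP] : forall g, exists w, forall i, t i = g -> w = nth point s i.
  move=> g; have [[j tj]|nti] := pselect (exists j, t j = g).
    by exists (nth point s j) => i; rewrite -tj => /t_inj ->.
  by exists (point : Omega) => i ti; case: nti; exists i.
pose y g := act xi (g * (r g)^-1)%g (v (r g)).
have yF f g : F f -> y (f * g)%g = act xi f (y g).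
  by move=> Ff; rewrite /y rF // -mulgA (actM xi f).
have yt i : y (t i) = nth point s i by rewrite /y rt mulgV act1; exact: vP.
(* Large enough to contain a representative for each of the points of s. *)
pose F' := generated_subgroup (F `|` t @` `I_(size s)).
have F'sub : is_subgroup F' := generated_is_subgroup _.
have [F'1 F'M F'V] := F'sub.
have F'fin : finite_set F'.
  apply: G_lf; rewrite finite_setU; split=> //.
  by apply: finite_image; exact: finite_II.
have FF' : F `<=` F' by move=> g Fg; apply: sub_generated; left.
have tF' i : (i < size s)%N -> F' (t i).
  by move=> si; apply: sub_generated; right; exists i.
have [r' [rF' Fr']] := coset_representatives F'sub.
pose A : set (G -> Omega) :=
  [set z | forall g, exists2 b, F' b & forall a, F' a -> z (a * g)%g = y (a * b)%g].
(* If no b worked for the coset of g, each b in the finite set F' would be refuted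
   by finitely many coordinates of z, hence by those of some point of A. *)
have clA : finitely_closed e A.
  move=> z zA g; apply: contrapT => nb.
  have /choice[w wP] : forall b, exists w : G * nat, F' b ->
      F' w.1 /\ ~ agree w.2 (z (w.1 * g)%g) (y (w.1 * b)%g).
    move=> b; have [Fb|nFb] := pselect (F' b); last by exists (1%g, 0%N).
    apply: contrapT => nw; apply: nb; exists b => // a Fa.
    apply: agree_eq => j; apply: contrapT => naj.
    by apply: nw; exists (a, j).
  have [N NP] := finite_set_bound (fun b => maxn (e ((w b).1 * g)%g).+1 (w b).2) F'fin.
  have [z' Az' zz'] := zA N; have [b Fb bP] := Az' g.
  have [Fwb] := wP b Fb; apply; rewrite -bP //.
  have := NP b Fb; rewrite geq_max => /andP[Ne Nw].
  exact: agree_le Nw (zz' _ Ne).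
have invA z g : A z -> A (fun h => z (h * g)%g).
  move=> Az h; have [b Fb bP] := Az (h * g)%g.
  by exists b => // a Fa; rewrite -mulgA bP.
have A1 x : exists2 z, A z & agree m x (z 1%g).
  have [p ps px] := sP x; pose b := t (index p s).
  have Fb : F' b by apply: tF'; rewrite index_mem.
  have Fr1 : F' (r' 1%g) by have := F'V _ (Fr' 1%g); rewrite mul1g invgK.
  (* On the coset of 1 this is y translated by b, so that its value at 1 is y b. *)
  exists (fun g => y (g * (r' g)^-1 * (r' 1 * b))%g).
    move=> g; exists (g * (r' g)^-1 * (r' 1 * b))%g => [|a Fa].
      by apply: (F'M) => //; exact: F'M.
    by rewrite rF' // !mulgA.
  by rewrite mul1g mulKg yt nth_index //; exact: agree_sym.
have [xi' [theta [tA _ tE t1]]] := subsystem_action R e_inj clA invA A1.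
have theta_orbit x : exists2 b, F' b & forall a, F' a -> theta x a = y (a * b)%g.
  have : A (theta x) by rewrite -tA.
  by move=> /(_ 1%g)[b Fb bP]; exists b => // a Fa; rewrite -bP // mulg1.
have theta_act a x : agree m (act xi' a x) (theta x a).
  by rewrite -[a in theta x a]mul1g -tE.
exists xi'.
  move=> g gn x; have Fg : F g by exact: sub_generated.
  have [b Fb bP] := theta_orbit x.
  apply: agree_sym; apply: agree_trans (agree_le nm (theta_act g x)) _.
  rewrite bP ?yF //; last exact: FF'.
  rewrite -[b in y b]mul1g -bP //.
  exact/agree_sym/mP.
have /finite_seqP[L LF'] := F'fin.
exists L => x u; have [b Fb bP] := theta_orbit x.
have [p ps pu] := sP u; pose a := (t (index p s) * b^-1)%g.
have Fa : F' a by apply: F'M; [apply: tF'; rewrite index_mem | exact: F'V].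
exists a; first by move: Fa; rewrite LF'.
apply: (agree_le (leq_trans kn nm)); apply: agree_trans (agree_sym pu) _.
apply: agree_sym; apply: agree_trans (theta_act a x) _.
by rewrite bP // /a mulgVK yt nth_index.
Qed.

Lemma equidense_open k : open (equidense k).
Proof.
rewrite openE => xi [s sP]; apply/(nbhs_actionsP e_inj).
exists (maxn k (\max_(h <- s) (e h).+1))%N => xi' c; exists s => x u.
have [h hs hP] := sP x u; exists h => //.
apply: agree_trans hP _; apply: agree_le (c h _ x); first exact: leq_maxl.
by rewrite leq_max orbC; rewrite (leq_bigmax_seq (F := fun h => (e h).+1)).
Qed.

Lemma equidense_minimal xi : (forall k, equidense k xi) -> minimal_actions xi.
Proof.
move=> xiE C clC invC; have [->|/set0P[x Cx]] := eqVneq C set0; first by left.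
right; apply/seteqP; split=> // u _; move/closed_cantorP : clC; apply => n.
have [s sP] := xiE n; have [h _ hP] := sP x u.
by exists (act xi h x) => //; apply: invC; exists x.
Qed.

Lemma locally_finite_comeager : comeager (@minimal_actions G).
Proof.
exists (fun k => ~` equidense k) => [k|xi nmin].
  rewrite /nowhere_dense.
  have /closure_id <- : closed (~` equidense k) by exact/open_closedC/equidense_open.
  apply/seteqP; split=> // xi /(nbhs_actionsP e_inj)[n nE].
  by have [xi' c] := equidense_dense xi n k; exact: nE.
apply: contrapT => ne; apply: nmin; apply: equidense_minimal => k.
by apply: contrapT => nk; apply: ne; exists k.
Qed.
End LocallyFinite.

(** * Geodesic rays in infinite finitely generated groups *)

Section Ray.
Variable (G : groupType) (T : seq G).

Fixpoint reach n (h : G) : Prop :=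
  if n is n'.+1 then exists t h', [/\ t \in T, reach n' h' & h = (t * h')%g]
  else h = 1%g.

Lemma reachM n k g h : reach n g -> reach k h -> reach (n + k) (g * h)%g.
Proof.
elim: n g => [|n IH] g; first by move=> -> ; rewrite mul1g.
move=> [t [g' [tT g'n ->]]] hk; exists t, (g' * h)%g.
by rewrite mulgA; split=> //; exact: IH.
Qed.

(** Words are read from the left in [reach]; this is the reading from the right. *)
Lemma reachSr n h : reach n.+1 h ->
  exists t h', [/\ t \in T, reach n h' & h = (h' * t)%g].
Proof.
elim: n h => [|n IH] h [t [h' [tT h'n ->]]].
  by exists t, 1%g; split=> //; rewrite h'n mulg1 mul1g.
have [u [k [uT kn ->]]] := IH _ h'n.
by exists u, (t * k)%g; split=> //; [exists t, k | rewrite mulgA].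
Qed.

Definition word_length h n := reach n h /\ forall k, reach k h -> (n <= k)%N.

Lemma word_length_uniq h n k : word_length h n -> word_length h k -> n = k.
Proof.
by move=> [hn n_min] [hk k_min]; apply/eqP; rewrite eqn_leq n_min // k_min.
Qed.

Lemma word_length_ex h n : reach n h -> exists k, word_length h k.
Proof.
move=> hn; have ex : exists k, `[< reach k h >] by exists n; apply/asboolP.
case: (ex_minnP ex) => k /asboolP hk k_min; exists k; split=> // j hj.
by apply: k_min; apply/asboolP.
Qed.

(** With g at distance n from 1, these are the elements h for which some geodesic
   from 1 to h passes through g. *)
Definition geodesic_cone g n : set G :=
  [set h | exists k w, [/\ reach k w, h = (w * g)%g & word_length h (n + k)]].

(** The step of Koenig's lemma: up to the point g itself, the cone of g is the union
   of the cones of those of its finitely many neighbours that lie one step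
   further from 1. *)
Lemma geodesic_cone_step g n :
  word_length g n -> infinite_set (geodesic_cone g n) ->
  exists2 t, t \in T &
    word_length (t * g)%g n.+1 /\ infinite_set (geodesic_cone (t * g)%g n.+1).
Proof.
move=> gn inf; apply: contrapT => no; apply: inf.
pose cone t := [set h | geodesic_cone (t * g)%g n.+1 h /\ word_length (t * g)%g n.+1].
apply: (@sub_finite_set _ _ ([set g] `|` \bigcup_(t in [set` T]) cone t)).
  move=> h [[|k] [w [wk hE hl]]]; first by left; rewrite /= hE wk mul1g.
  have [t [w' [tT w'k wE]]] := reachSr wk.
  have hE' : h = (w' * (t * g))%g by rewrite hE wE mulgA.
  right; exists t => //; split; first by exists k, w'; rewrite addSnnS.
  split; first by exists t, g; split=> //; case: gn.
  move=> j tj; case: hl => _ /(_ (k + j)%N); rewrite hE' => /(_ (reachM w'k tj)).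
  by rewrite addnS -addSn addnC leq_add2l.
rewrite finite_setU; split; first exact: finite_set1.
apply: bigcup_finite => // t tT.
have [tl|ntl] := pselect (word_length (t * g)%g n.+1); last first.
  by apply: (@sub_finite_set _ _ set0) => // h [].
apply: contrapT => cinf; apply: no; exists t => //; split=> // cfin; apply: cinf.
by apply: sub_finite_set cfin => h [].
Qed.

(** Successive elements of the ray have word lengths 0, 1, 2, and so on, whence
   injectivity. *)
Lemma geodesic_ray : infinite_set [set h | exists n, reach n h] ->
  exists2 gamma : nat -> G, injective gamma & gamma 0%N = 1%g /\
    forall n, exists2 t, t \in T & gamma n.+1 = (t * gamma n)%g.
Proof.
move=> Hinf; pose good (p : G * nat) :=
  word_length p.1 p.2 /\ infinite_set (geodesic_cone p.1 p.2).
have good0 : good (1%g, 0%N).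
  split; first by split.
  move=> cfin; apply: Hinf; apply: sub_finite_set cfin => h [n hn].
  have [k hk] := word_length_ex hn; exists k, h; split=> //; first by case: hk.
  by rewrite mulg1.
have /choice[f fP] : forall p : G * nat, exists t, good p ->
    t \in T /\ good (t * p.1, p.2.+1)%g.
  move=> p; have [[pl pinf]|np] := pselect (good p); last by exists 1%g.
  by have [t tT [tl tinf]] := geodesic_cone_step pl pinf; exists t.
pose gamma := fix gamma n : G :=
  if n is k.+1 then (f (gamma k, k) * gamma k)%g else 1%g.
have gamma_good n : good (gamma n, n).
  by elim: n => [//|n IH]; have [] := fP _ IH.
exists gamma.
  move=> i j gij; have [il _] := gamma_good i; have [jl _] := gamma_good j.
  by apply: (word_length_uniq il); rewrite /= gij.
split=> // n; exists (f (gamma n, n)) => //.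
by have [] := fP _ (gamma_good n).
Qed.

End Ray.

Lemma infinite_generated_ray (G : groupType) (S : set G) :
  finite_set S -> infinite_set (generated_subgroup S) ->
  exists (T : seq G) (gamma : nat -> G), [/\ injective gamma, gamma 0%N = 1%g &
    forall n, exists2 t, t \in T & gamma n.+1 = (t * gamma n)%g].
Proof.
move=> /finite_seqP[s ->] Sinf.
(* Inverses are added so that words in T reach a subgroup. *)
pose T := s ++ [seq (x^-1)%g | x <- s].
have TV t : t \in T -> (t^-1)%g \in T.
  rewrite !mem_cat => /orP[ts|/mapP[x xs ->]]; last by rewrite invgK xs.
  by rewrite orbC map_f.
have [|gamma gi [g0 gS]] := @geodesic_ray G T; last by exists T, gamma.
apply: sub_infinite_set Sinf; apply: smallest_sub.
  split; first by exists 0%N.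
    by move=> g h [n gn] [k hk]; exists (n + k)%N; exact: reachM.
  move=> g [n gn]; exists n; elim: n g gn => [_ ->|n IH _ [t [h [tT hn ->]]]].
    by rewrite invg1.
  rewrite -addn1 invgM; apply: reachM (IH _ hn) _.
  by exists (t^-1)%g, 1%g; rewrite mulg1; split=> //; exact: TV.
by move=> x xs; exists 1%N, x, 1%g; rewrite mulg1; split=> //; rewrite mem_cat xs.
Qed.

(** * Invariant means *)

Section Mean.
Variables (R : realType) (G : groupType) (m : set G -> R).
Hypothesis m_ge0 : forall A, (0 <= m A)%R.
Hypothesis m_T : m setT = 1%R.
Hypothesis m_add : forall A B, A `&` B = set0 -> m (A `|` B) = (m A + m B)%R.
Hypothesis m_inv : forall g A, m [set (g * a)%g | a in A] = m A.

Lemma mean_setID A B : m A = (m (A `&` B) + m (A `\` B))%R.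
Proof. by rewrite -m_add ?setUIDK// setDE setIACA setICr setI0. Qed.

Lemma mean_le A B : A `<=` B -> (m A <= m B)%R.
Proof. by move=> /setIidr AB; rewrite (mean_setID B A) AB lerDl. Qed.

Lemma mean_translate g A : m [set h | A (g * h)%g] = m A.
Proof.
rewrite -(m_inv g); congr m; apply/seteqP; split=> [_ [h Ah <-]//|h Ah].
by exists (g^-1 * h)%g; rewrite /= ?mulVKg.
Qed.

(** The map g |-> lambda g * g is a left translation on each of the finitely many
   level sets of lambda. *)
Lemma mean_image (lambda : G -> G) (L : seq G) (E : set G) :
  {in E &, injective (fun g => lambda g * g)%g} ->
  (forall g, E g -> lambda g \in L) ->
  m [set (lambda g * g)%g | g in E] = m E.
Proof.
elim: L E => [|s L IH] E injE EL.
  suff -> : E = set0 by rewrite image_set0.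
  by apply/seteqP; split=> // g /EL.
pose B := [set g | lambda g = s].
have -> : [set (lambda g * g)%g | g in E] =
    [set (s * g)%g | g in E `&` B] `|` [set (lambda g * g)%g | g in E `\` B].
  apply/seteqP; split=> [_ [g Eg <-]|_ [[g [Eg gs] <-]|[g [Eg _] <-]]].
  - by have [gs|gs] := pselect (B g); [left; exists g; rewrite ?gs | right; exists g].
  - by exists g => //; rewrite gs.
  - by exists g.
rewrite m_add; last first.
  apply/seteqP; split=> // _ [[g [Eg gs] <-] [h [Eh hs]]].
  rewrite -gs => /(injE _ _ (mem_set Eh) (mem_set Eg)) hg.
  by apply: hs; rewrite hg.
rewrite m_inv IH; first by rewrite -mean_setID.
- move=> g h /set_mem[Eg _] /set_mem[Eh _].
  by apply: injE; exact: mem_set.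
- by move=> g [/EL]; rewrite inE => /predU1P[].
Qed.

(** The image of the compression already carries the whole mass. *)
Lemma mean_compression (lambda : G -> G) (L : seq G) (D : set G) :
  injective (fun g => lambda g * g)%g -> (forall g, lambda g \in L) ->
  (forall g, ~ D (lambda g * g)%g) -> m D = 0%R.
Proof.
move=> inj_l lL lD; apply/eqP; rewrite eq_le m_ge0 andbT.
have := @mean_le (range (fun g => lambda g * g)%g `|` D) setT (@subsetT _ _).
rewrite m_add; last by apply/seteqP; split=> // _ [[g _ <-] /lD].
rewrite (@mean_image _ L) ?m_T ?gerDl //.
by move=> g h _ _; exact: inj_l.
Qed.

Lemma mean_null_not_syndetic (D : set G) (s : seq G) :
  m D = 0%R -> ~ (forall h, exists2 g, g \in s & D (g * h)%g).
Proof.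
move=> D0 sD.
suff : m [set h | exists2 g, g \in s & D (g * h)%g] = 0%R.
  rewrite (_ : [set h | _] = setT); last by apply/seteqP; split=> // h _; exact: sD.
  by rewrite m_T => /eqP; rewrite oner_eq0.
elim: s {sD} => [|g s IH].
  rewrite (_ : [set h | _] = set0); last by apply/seteqP; split=> // h [].
  by apply: (addrI (m set0)); rewrite addr0 -m_add ?setU0 ?setI0.
apply/eqP; rewrite eq_le m_ge0 andbT.
rewrite (mean_setID _ [set h | D (g * h)%g]) -[X in (_ <= X)%R]addr0 lerD //.
  by rewrite -D0 -(mean_translate g D); apply: mean_le => h [].
rewrite -IH; apply: mean_le => h [[k]]; rewrite inE => /predU1P[->//|ks Dk] _.
by exists k.
Qed.

End Mean.

(** * Compressing actions *)

(** The points whose orbits avoid a given cylinder form a closed invariant proper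
   subset, which is empty by minimality; compactness then bounds the group
   elements needed. *)
Lemma minimal_orbits_hit (G : groupType) (xi : actions G) n (u : Omega) :
  minimal_actions xi ->
  exists s : seq G, forall x, exists2 g, g \in s & agree n u (act xi g x).
Proof.
move=> xi_min; have hit x : exists g, agree n u (act xi g x).
  pose C := [set y | forall g, ~ agree n u (act xi g y)].
  have clC : closed C.
    apply/closed_cantorP => y yC g ug.
    have /continuous_cantorP/(_ y n)[k kP] := @act_continuous _ xi g.
    by have [z Cz /kP yz] := yC k; apply: (Cz g); exact: agree_trans yz.
  have invC g : act xi g @` C `<=` C.
    by move=> _ [y Cy <-] h; rewrite -actM; exact: Cy.
  apply: contrapT => nx; have Cx : C x by move=> g ug; apply: nx; exists g.
  have [C0|CT] := xi_min C clC invC; first by rewrite C0 in Cx.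
  have : C u by rewrite CT.
  by move=> /(_ 1%g); rewrite act1; apply.
have /choice[g gP] := hit.
have /choice[V VP] : forall x, exists k, forall y, agree k x y ->
    agree n (act xi (g x) x) (act xi (g x) y).
  by move=> x; have /continuous_cantorP/(_ x n) := @act_continuous _ xi (g x).
have [s sP] := cantor_finite_subcover V.
exists [seq g x | x <- s] => y; have [x xs /VP xy] := sP y.
by exists (g x); [exact: map_f | exact: agree_trans xy].
Qed.

(** The mean of G is read on the subsets of G that consist of the elements sending
   the base point u into a given part of Omega.  Along the orbit of u, the map
   x |-> lambda x * x becomes a compression of G. *)
Lemma compressing_not_minimal (R : realType) (G : groupType) (xi : actions G)
    (lambda : Omega -> G) (L : seq G) n (u : Omega) :
  amenable R G -> (forall x, lambda x \in L) ->
  injective (fun x => act xi (lambda x) x) ->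
  (forall x, ~ agree n u (act xi (lambda x) x)) ->
  ~ minimal_actions xi.
Proof.
move=> [m [m_ge0 m_T m_add m_inv]] lL l_inj lu xi_min.
pose orbit g := act xi g u.
have [s sP] := minimal_orbits_hit n u xi_min.
apply: (mean_null_not_syndetic m_ge0 m_T m_add m_inv (s := s)
  (D := [set g | agree n u (orbit g)])); last first.
  by move=> h; have [g gs ug] := sP (orbit h); exists g => //; rewrite /= /orbit actM.
apply: (mean_compression m_ge0 m_T m_add m_inv (L := L)
  (lambda := lambda \o orbit)) => //=.
- move=> g h /= gh; have /l_inj orb : act xi (lambda (orbit g)) (orbit g) =
      act xi (lambda (orbit h)) (orbit h) by rewrite -!actM gh.
  by move: gh; rewrite orb => /mulgI.
- by move=> g; rewrite /orbit actM; exact: lu.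
Qed.

Section Compressing.
Variables (R : realType) (G : groupType) (e : G -> nat).
Hypothesis e_inj : injective e.

(** Both conclusions are stated up to n coordinates so that they persist in nearby
   actions.  The configurations z in A code the multiplier of g by a label of
   z g; as [label] is locally constant, A is closed.  The multiplier
   used at x can be recovered from its image w: it is the only s for which the
   injection coded by theta w sends s^-1 to 1.  For each of the finitely many s
   this condition is decided by a prefix of w. *)
Lemma compressing_action (T : seq G) (gamma : nat -> G) :
  injective gamma -> gamma 0%N = 1%g ->
  (forall n, exists2 t, t \in T & gamma n.+1 = (t * gamma n)%g) ->
  exists (xi : actions G) (lambda : Omega -> G) (L : seq G) (n : nat) (u : Omega),
  [/\ forall x, lambda x \in L,
      forall x y, agree n (act xi (lambda x) x) (act xi (lambda y) y) ->
        lambda x = lambda y &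
      forall x, ~ agree n u (act xi (lambda x) x)].
Proof.
move=> gamma_inj gamma0 gammaS.
pose L := 1%g :: T.
(* The number of leading zeros of x, if less than the size of T, selects an element
   of T; otherwise the default value 1 of nth is taken. *)
pose label (x : Omega) := nth 1%g T (find x (iota 0 (size T))).
have labelL x : label x \in L.
  rewrite inE /label; have [lt|ge] := ltnP (find x (iota 0 (size T))) (size T).
    by rewrite mem_nth ?orbT.
  by rewrite nth_default ?eqxx.
have label_agree x y : agree (size T) x y -> label x = label y.
  move=> xy; congr nth; apply: eq_in_find => i; rewrite mem_iota => /andP[_ iT].
  exact: xy.
have label_surj t : t \in L -> exists x, label x = t.
  rewrite inE => /predU1P[->|tT].
    exists (fun=> false); rewrite /label nth_default //.
    by rewrite leqNgt -[X in (_ < X)%N](size_iota 0) -has_find has_pred0.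
  have it : (index t T < size T)%N by rewrite index_mem.
  exists (pred1 (index t T)); rewrite /label (_ : find _ _ = index t T) ?nth_index //.
  have := @index_uniq _ 0%N (index t T) (iota 0 (size T)).
  by rewrite size_iota nth_iota // add0n; apply=> //; exact: iota_uniq.
pose A := [set z : G -> Omega | injective (fun g => label (z g) * g)%g].
have clA : finitely_closed e A.
  move=> z zA g h /= gh.
  have [a Aa za] := zA (maxn (size T) (maxn (e g) (e h)).+1).
  have za' k : (e k <= maxn (e g) (e h))%N -> label (z k) = label (a k).
    move=> ek; apply: label_agree; apply: agree_le (za k _); first exact: leq_maxl.
    by rewrite leq_max ltnS ek orbT.
  by apply: Aa; rewrite /= -!za' ?leq_maxl ?leq_maxr.
have invA z k : A z -> A (fun h => z (h * k)%g).
  by move=> Az g h /= gh; apply: (mulIg k); apply: Az; rewrite /= !mulgA gh.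
(* The shift along the ray, which misses the origin of the ray. *)
have [z0 Az0 z0_miss] : exists2 z0, A z0 & forall g, (label (z0 g) * g)%g <> 1%g.
  have /choice[z0 z0P] : forall g, exists x,
      (forall n, gamma n = g -> (label x * g)%g = gamma n.+1) /\
      ((forall n, gamma n <> g) -> label x = 1%g).
    move=> g; have [[n gn]|ng] := pselect (exists n, gamma n = g).
      have [t tT gS] := gammaS n.
      have [|x xt] := label_surj t; first by rewrite inE tT orbT.
      exists x; split=> [k|/(_ n)//]; rewrite -gn => /gamma_inj ->.
      by rewrite xt gS.
    have [|x x1] := label_surj 1%g; first by rewrite inE eqxx.
    by exists x; split=> // n gn; case: ng; exists n.
  have z0_cases g : (exists n, gamma n = g /\ (label (z0 g) * g)%g = gamma n.+1) \/
      ((forall n, gamma n <> g) /\ (label (z0 g) * g)%g = g).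
    have [z0g z0ng] := z0P g.
    have [[n gn]|ng] := pselect (exists n, gamma n = g).
      by left; exists n; split=> //; exact: z0g.
    have gamma_ng n : gamma n <> g by move=> gn; apply: ng; exists n.
    by right; split=> //; rewrite z0ng ?mul1g.
  exists z0 => [g h /=|g].
    have [[n [gn ->]]|[ng ->]] := z0_cases g;
      have [[k [hk ->]]|[nh ->]] := z0_cases h => //.
    - by rewrite -gn -hk => /gamma_inj[->].
    - by move=> /nh.
    - by move=> /esym/ng.
  have [[n [_ ->]]|[ng ->]] := z0_cases g; rewrite -gamma0.
    by move=> /gamma_inj.
  by move=> g1; apply: (ng 0%N).
have A1 x : exists2 z, A z & agree 0 x (z 1%g) by exists z0.
have [xi [theta [tA tc tE _]]] := subsystem_action R e_inj clA invA A1.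
pose lambda x := label (theta x 1%g).
have theta_inj x : injective (fun g => label (theta x g) * g)%g.
  by have : A (theta x) by rewrite -tA.
have [n nP] : exists n, forall x y, agree n x y -> forall s, s \in L ->
    label (theta x s^-1%g) = label (theta y s^-1%g).
  have /choice[N NP] : forall s, exists n, forall x y, agree n x y ->
      label (theta x s^-1%g) = label (theta y s^-1%g).
    move=> s; have [k kP] := unif_continuous_cantor (size T) tc.
    have [n nP] := unif_continuous_cantor k (@act_continuous _ xi s^-1%g).
    by exists n => x y /nP/kP/label_agree; rewrite !tE !mul1g.
  exists (\max_(s <- L) N s)%N => x y xy s sL; apply: NP.
  by apply: agree_le xy; exact: leq_bigmax_seq.
have lambda_hit x :
    (label (theta (act xi (lambda x) x) (lambda x)^-1) * (lambda x)^-1)%g = 1%g.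
  by rewrite tE mulVg mulgV.
have [u uz0] : exists u, theta u = z0.
  have : range theta z0 by rewrite tA.
  by case=> u _ <-; exists u.
exists xi, lambda, L, n, u; split=> [x|x y xy|x ux]; first exact: labelL.
- apply: invg_inj; apply: (theta_inj (act xi (lambda y) y)) => /=.
  by rewrite lambda_hit -(nP _ _ xy) ?lambda_hit //; exact: labelL.
- apply: (z0_miss (lambda x)^-1%g); rewrite -uz0.
  by rewrite (nP _ _ ux) ?lambda_hit //; exact: labelL.
Qed.

Lemma comeager_locally_finite : amenable R G ->
  comeager (@minimal_actions G) -> locally_finite G.
Proof.
move=> amG cm S Sfin; apply: contrapT => Sinf.
have [T [gamma [gi g0 gS]]] := infinite_generated_ray Sfin Sinf.
have [xi0 [lambda [L [n [u [lL l_sep lu]]]]]] := compressing_action gi g0 gS.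
pose N := maxn n (\max_(s <- L) (e s).+1)%N.
(* N exceeds the numbers of all multipliers, so in V they are all controlled. *)
pose V := [set xi : actions G | close_upto e N xi0 xi].
have [F F0 FV] := cm.
apply: (actions_baire e_inj (V := V)); last first.
- exists F => //; apply: subset_trans FV => xi close.
  have move_close x : agree n (act xi0 (lambda x) x) (act xi (lambda x) x).
    apply: agree_le (close _ _ x); first exact: leq_maxl.
    rewrite /N leq_max orbC.
    by rewrite (leq_bigmax_seq (F := fun s => (e s).+1)) ?lL.
  apply: (@compressing_not_minimal R G xi lambda L n u amG lL) => [x y xy|x ux];
    last first.
    by apply: (lu x); exact: agree_trans ux (agree_sym (move_close x)).
  have lxy : lambda x = lambda y.
    apply: l_sep; apply: agree_trans (move_close x) _.
    by rewrite xy; exact/agree_sym/move_close.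
  by move: xy; rewrite lxy => /(can_inj (actK xi _)).
- by exists xi0.
- rewrite openE => xi close; apply/(nbhs_actionsP e_inj); exists N => xi'.
  exact: close_upto_trans.
Qed.
End Compressing.

Theorem theorem1p6 (R : realType) (G : groupType)
    (countableG : countable [set: G]) (infiniteG : infinite_set [set: G])
    (amenableG : amenable R G) :
  locally_finite G <-> comeager (@minimal_actions G).
Proof.
have /countable_injP[e e_inj'] := countableG.
have e_inj : injective e by move=> g h; apply: e_inj'; rewrite inE.
split=> [lfG|]; first exact: (locally_finite_comeager R e_inj infiniteG lfG).
exact: (comeager_locally_finite e_inj amenableG).
Qed.
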